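(* Let $\mathcal T$ be the dyadic extension of a dyadic grid $\mathcal D$ on $\partial\Omega$. For any $0<\alpha<1$ and $q>p>1$ satisfying $\frac1p-\frac1q=\alpha$, the fractional maximal operator $$\mathcal M_{\mathcal T,\alpha}f(z)=\sup_{z\in T(Q)\in\mathcal T}\mathrm{Vol}(T(Q))^\alpha\langle f\rangle_{T(Q)}$$ is bounded from $L^p(\Omega)$ to $L^q(\Omega)$.
   Context: $\Omega\subset\mathbb C^n$ is a smooth, bounded, strictly pseudoconvex domain with boundary $\partial\Omega$; $dV$ is Lebesgue measure, $\mathrm{Vol}$ the corresponding volume, $L^p(\Omega)$ is taken with respect to $dV$, and $\langle f\rangle_E=\frac1{\mathrm{Vol}(E)}\int_E|f|\,dV$. Boundary quasi-metric. Let $\rho$ be a defining function of $\Omega$ with $|\nabla\rho|=1$ on $\partial\Omega$. For $q$ in a small neighborhood of $\partial\Omega$ and small $r>0$ there is a holomorphic coordinate system $z=(z_1,\dots,z_n)$ centered at $q$ such that $D(q,r)=\{|z_j|<\tau_j(q,r),\ j=1,\dots,n\}$, with $\tau_1(q,r)=r$ and $\tau_j(q,r)\approx r^{1/2}$ for $j\ge2$, is the largest polydisc centered at $q$ on which $\rho$ changes by no more than $r$ from its value at $q$. For $z\in\partial\Omega$ put $B(z,r)=D(z,r)\cap\partial\Omega$ and $d(z,z')=\inf\{r>0:z'\in B(z,r)\}$; with $\sigma$ the normalized surface measure, $(\partial\Omega,d,\sigma)$ is a space of homogeneous type, and $B(z,r)$ is identified with $\{w\in\partial\Omega: d(z,w)<r\}$.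 Dyadic grids. A dyadic grid on $\partial\Omega$ is a family $\mathcal D=\bigcup_{k\ge1}\mathcal D_k$ of subsets (dyadic cubes) with centers $c(Q)\in\partial\Omega$ and constants $\mathfrak C>0$, $0<\delta,\epsilon<1$ such that: $\partial\Omega=\bigcup_{Q\in\mathcal D_k}Q$ for each $k$; two intersecting cubes are nested; each $Q\in\mathcal D_k$ contains at least one child in $\mathcal D_{k+1}$ and lies in exactly one parent in $\mathcal D_{k-1}$; $\sigma(Q_2)\ge\epsilon\sigma(Q_1)$ if $Q_2$ is a child of $Q_1$; and $B(c(Q),\delta^k)\subset Q\subset B(c(Q),\mathfrak C\delta^k)$ for $Q\in\mathcal D_k$. The sidelength of $Q\in\mathcal D_k$ is $\ell(Q)=\delta^k$. The grid is augmented by a $0$-th generation $\{\partial\Omega\}$. Tents. Let $\varepsilon_0>0$ be small, so that the nearest-point projection $\pi$ onto $\partial\Omega$ is well defined and smooth on the Euclidean $\varepsilon_0$-neighborhood of $\partial\Omega$; assume $\delta<\varepsilon_0$. For $Q\in\mathcal D_k$, $k\ge1$, $T(Q)=\{w\in\Omega:\pi(w)\in Q,\ \mathrm{dist}(\pi(w),w)\le\ell(Q)\}$, and $T(\partial\Omega)=\Omega$. The dyadic extension of $\mathcal D$ is the collection $\mathcal T$ of all tents $T(Q)$, $Q\in\mathcal D_k$, $k\ge1$, together with $\Omega=T(\partial\Omega)$. *)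

(* Defs.v *)
From HB Require Import structures.
From mathcomp Require Import all_boot all_order all_algebra.
From mathcomp Require Import complex.
From mathcomp Require Import all_classical all_reals all_analysis.
From mathcomp Require Import measurable_realfun.

Set Implicit Arguments.
Unset Strict Implicit.
Unset Printing Implicit Defensive.

Import Order.TTheory GRing.Theory Num.Theory.
Import numFieldNormedType.Exports.

Local Open Scope classical_set_scope.
Local Open Scope ring_scope.

(* MathComp-Analysis gives a topology and a norm to an abstract numFieldType;
   the concrete type R[i] of complex numbers needs its own copy. *)
Section complex_normed.
Variable R : realType.
HB.instance Definition _ := PseudoPointedMetric.copy R[i] (R[i])^o.
HB.instance Definition _ := Vector.copy R[i] (R[i])^o.
HB.instance Definition _ := NormedModule.copy R[i] (R[i])^o.
End complex_normed.

(* Complex Euclidean space of dimension n + 1: the parameter n is the complex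
   dimension minus one, so that all dimensions >= 1 are covered. *)
Notation Cn R n := 'rV[R[i]]_n.+1.

Definition cabs (R : realType) (x : R[i]) : R :=
  Num.sqrt (complex.Re x ^+ 2 + complex.Im x ^+ 2).

Section euclidean.
Variables (R : realType) (n : nat).
Implicit Types (z w : Cn R n) (A : set (Cn R n)).

(* The library norm `|z| on row vectors is the sup norm; it is used only for
   the topology. *)
Definition eucl_norm z : R := Num.sqrt (\sum_j cabs (z 0 j) ^+ 2).

Definition eucl_dist z w : R := eucl_norm (z - w).

Definition dist_to A w : R := inf [set eucl_dist w z | z in A].

Definition bdry A : set (Cn R n) := closure A `\` interior A.

Definition borel A : Prop := (<<s @open (Cn R n) >>) A.

End euclidean.

Section lebesgue.
Variables (R : realType) (n : nat).
Implicit Types (p : Cn R n * Cn R n) (A : set (Cn R n)).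

(* Half-open boxes in R^(2(n+1)) with opposite corners p.1 and p.2. *)
Definition box p : set (Cn R n) := [set z | forall j,
  [/\ complex.Re (p.1 0 j) < complex.Re (z 0 j),
      complex.Re (z 0 j) <= complex.Re (p.2 0 j),
      complex.Im (p.1 0 j) < complex.Im (z 0 j) &
      complex.Im (z 0 j) <= complex.Im (p.2 0 j)]].

Definition box_vol p : R := \prod_j
  (Num.max 0 (complex.Re (p.2 0 j) - complex.Re (p.1 0 j)) *
   Num.max 0 (complex.Im (p.2 0 j) - complex.Im (p.1 0 j))).

Definition lebesgue_outer A : \bar R := ereal_inf
  [set (\sum_(0 <= k <oo) (box_vol (c k))%:E)%E |
    c in [set c : nat -> Cn R n * Cn R n | A `<=` \bigcup_k box (c k)]].

Lemma box_vol_ge0 p : 0 <= box_vol p.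
Proof. by apply: prodr_ge0 => j _; rewrite mulr_ge0// le_max lexx. Qed.

Lemma lebesgue_outer_ge0 A : (0 <= lebesgue_outer A)%E.
Proof.
apply: le_ereal_inf_tmp => _ [c _ <-].
by apply: nneseries_ge0 => k _ _; rewrite lee_fin box_vol_ge0.
Qed.

Lemma lebesgue_outer0 : lebesgue_outer set0 = 0%E.
Proof.
apply/eqP; rewrite eq_le lebesgue_outer_ge0 andbT.
apply: ereal_inf_lbound; exists (fun=> (0, 0)); first exact: sub0set.
apply: eseries0 => k _ _; rewrite /box_vol (bigD1 ord0)//= !mxE subrr.
by rewrite maxxx !mul0r.
Qed.

Lemma le_lebesgue_outer : {homo lebesgue_outer : A B / A `<=` B >-> (A <= B)%E}.
Proof.
move=> A B AB; apply: le_ereal_inf => _ [c Bc <-].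
by exists c => //; exact: subset_trans Bc.
Qed.

Lemma lebesgue_outer_sigma_subadditive : sigma_subadditive lebesgue_outer.
Proof.
move=> A; have [[i ioo]|] := pselect (exists i, lebesgue_outer (A i) = +oo%E).
  rewrite (eseries_pinfty _ _ ioo) ?leey// => k _.
  by rewrite -ltNye (lt_le_trans _ (lebesgue_outer_ge0 _)).
rewrite -forallNE => Aoo.
suff add2e (e : {posnum R}) : (lebesgue_outer (\bigcup_n A n) <=
    \sum_(i <oo) lebesgue_outer (A i) + e%:num%:E)%E.
  by apply/lee_addgt0Pr => _/posnumP[].
rewrite (le_trans _ (epsilon_trick _ _ _))//; last first.
  by move=> k; exact: lebesgue_outer_ge0.
pose P k (c : nat -> Cn R n * Cn R n) := A k `<=` \bigcup_j box (c j) /\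
  (\sum_(j <oo) (box_vol (c j))%:E <=
   lebesgue_outer (A k) + (e%:num / (2 ^ k.+1)%:R)%:E)%E.
have [G PG] : {G : nat -> nat -> Cn R n * Cn R n & forall k, P k (G k)}.
  apply: (@choice _ _ P) => k; rewrite /P.
  case E : (lebesgue_outer (A k)) => [r| |].
  - have en1 : 0 < e%:num / (2 ^ k.+1)%:R by [].
    have /(lb_ereal_inf_adherent en1) : lebesgue_outer (A k) \is a fin_num.
      by rewrite E.
    move=> [x [c Ac cx] xS]; exists c; split => //.
    by rewrite cx -E; exact/ltW.
  - by have := Aoo k; rewrite E.
  - by have := lebesgue_outer_ge0 (A k); rewrite E.
pose v := fun x : nat * nat => (box_vol (uncurry G x))%:E.
have v0 x : (0 <= v x)%E by rewrite lee_fin box_vol_ge0.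
apply: (@le_trans _ _ (\esum_(i in setT) v i)%E).
  apply: ereal_inf_lbound => /=.
  have /card_esym/ppcard_eqP[f] := card_nat2.
  exists (uncurry G \o f).
    move=> t [i _] /(PG i).1 [j _ Gt]; exists (f^-1%FUN (i, j)) => //=.
    by rewrite invK ?inE.
  rewrite -(esum_pred_image v _ xpredT) ?[fun=> _]set_true//.
  by rewrite image_eq.
rewrite (_ : esum _ _ = \sum_(i <oo) \sum_(j <oo) v (i, j))%E; last first.
  pose J : nat -> set (nat * nat) := fun i => [set (i, j) | j in setT].
  rewrite (_ : setT = \bigcup_k J k); last first.
    by rewrite predeqE => -[a b]; split => // _; exists a => //; exists b.
  rewrite esum_bigcupT//=; last first.
    apply/trivIsetP => i j _ _ ij.
    rewrite predeqE => -[k m] /=; split => //= -[] [_] _ [<-{k} _].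
    by move=> [m' _] [] /esym/eqP; rewrite (negbTE ij).
  rewrite -(image_id [set: nat]) -fun_true esum_pred_image//; last first.
    by move=> k _; exact: esum_ge0.
  apply: eq_eseriesr => /= j _.
  rewrite -(esum_pred_image v (pair j) predT)//=; last first.
    by move=> ? ? _ _; exact: (@can_inj _ _ _ snd).
  by congr esum; rewrite predeqE => -[a b]; split; move=> [i _ <-]; exists i.
apply: lee_nneseries; last by move=> k _; exact: (PG k).2.
by move=> k _ _; apply: nneseries_ge0 => m _ _; exact: v0.
Qed.

HB.instance Definition _ := isOuterMeasure.Build R (Cn R n) lebesgue_outer
  lebesgue_outer0 lebesgue_outer_ge0 le_lebesgue_outer
  lebesgue_outer_sigma_subadditive.

(* Complex space with the sigma-algebra of Lebesgue measurable sets, and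
   Lebesgue measure dV (Vol E = dV E). *)
Definition LebCn := caratheodory_type lebesgue_outer.
HB.instance Definition _ := Measurable.on LebCn.

Definition dV : set LebCn -> \bar R := lebesgue_outer.
HB.instance Definition _ := isMeasure.Build _ LebCn R dV
  (@caratheodory_measure0 R (Cn R n) lebesgue_outer)
  (@caratheodory_measure_ge0 R (Cn R n) lebesgue_outer)
  (@caratheodory_measure_sigma_additive R (Cn R n) lebesgue_outer).

End lebesgue.

Section surface.
Variables (R : realType) (n : nat).
Implicit Types (A E : set (Cn R n)).

Definition ediam A : \bar R := ereal_sup
  (0%E |` [set (eucl_dist x.1 x.2)%:E | x in A `*` A]).

(* (2(n+1)-1)-dimensional Hausdorff measure for the Euclidean distance, up to
   the usual constant factor, which disappears in the normalization below. *)
Definition hausdorff_content (delta : R) A : \bar R := ereal_inf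
  [set (\sum_(0 <= k <oo) ediam (V k) ^+ n.*2.+1)%E |
    V in [set V : nat -> set (Cn R n) |
      A `<=` \bigcup_k V k /\ forall k, (ediam (V k) <= delta%:E)%E]].

Definition hausdorff_measure A : \bar R := ereal_sup
  [set hausdorff_content delta A | delta in [set delta : R | 0 < delta]].

Definition surface_measure (Om E : set (Cn R n)) : \bar R :=
  (((fine (hausdorff_measure (bdry Om)))^-1)%:E *
    hausdorff_measure (E `&` bdry Om))%E.

End surface.

Section calculus.
Variables (R : realType) (n : nat).
Implicit Types (f : Cn R n -> R) (g : Cn R n -> R[i]) (U : set (Cn R n))
  (z v w : Cn R n).

(* Real directional derivative along v. *)
Definition pderiv v f z : R := derive1 (fun t : R => f (z + (t%:C)%C *: v)) 0.

(* C^infinity on the open set U: all iterated directional derivatives exist and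
   are continuous at every point of U. *)
Definition smooth_on U f : Prop := forall (vs : seq (Cn R n)) z, U z ->
  {for z, continuous (foldr pderiv f vs)} /\
  forall v, derivable (fun t : R => foldr pderiv f vs (z + (t%:C)%C *: v)) 0 1.

Definition smooth_map_on U (F : Cn R n -> Cn R n) : Prop := forall j,
  smooth_on U (fun z => complex.Re (F z 0 j)) /\
  smooth_on U (fun z => complex.Im (F z 0 j)).

Definition dirx (j : 'I_n.+1) : Cn R n := delta_mx 0 j.
Definition diry (j : 'I_n.+1) : Cn R n := 'i%C *: delta_mx 0 j.

Definition grad_norm f z : R :=
  Num.sqrt (\sum_j (pderiv (dirx j) f z ^+ 2 + pderiv (diry j) f z ^+ 2)).

Definition cpderiv v g z : R[i] :=
  (pderiv v (fun x => complex.Re (g x)) z +i*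
   pderiv v (fun x => complex.Im (g x)) z)%C.

Definition d_dz (j : 'I_n.+1) g z : R[i] :=
  2^-1 * (cpderiv (dirx j) g z - 'i%C * cpderiv (diry j) g z).
Definition d_dzbar (j : 'I_n.+1) g z : R[i] :=
  2^-1 * (cpderiv (dirx j) g z + 'i%C * cpderiv (diry j) g z).

Definition levi_form f z w : R[i] :=
  \sum_j \sum_k d_dz j (d_dzbar k (fun x => ((f x)%:C)%C)) z *
                w 0 j * (w 0 k)^*%C.

Definition complex_tangent f z w : Prop :=
  \sum_j d_dz j (fun x => ((f x)%:C)%C) z * w 0 j = 0.

(* Frechet differentiability over R[i], i.e. complex differentiability. *)
Definition holomorphic_on U (F : Cn R n -> Cn R n) : Prop :=
  forall z, U z -> differentiable F z.

Definition holo_coords_at (V : set (Cn R n)) (Phi : Cn R n -> Cn R n) z :=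
  [/\ open V /\ V z, Phi z = 0, holomorphic_on V Phi, open (Phi @` V) &
      exists2 Psi, holomorphic_on (Phi @` V) Psi &
                   forall w, V w -> Psi (Phi w) = w].

End calculus.

Section domains.
Variables (R : realType) (n : nat).
Implicit Types (Om U : set (Cn R n)) (rho : Cn R n -> R).

(* The defining function is only required to be defined near the boundary. *)
Definition defining_function Om U rho : Prop :=
  [/\ open U, bdry Om `<=` U, smooth_on U rho,
      forall z, U z -> (Om z <-> rho z < 0) /\ (bdry Om z <-> rho z = 0) &
      forall z, bdry Om z -> grad_norm rho z != 0].

Definition smooth_strictly_pseudoconvex Om : Prop :=
  exists U rho, defining_function Om U rho /\
    forall z w, bdry Om z -> w != 0 -> complex_tangent rho z w ->
      0 < levi_form rho z w.

Definition bounded_domain Om : Prop :=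
  [/\ open Om, connected Om, Om !=set0 & bounded_set Om].

End domains.

Section polydiscs.
Variables (R : realType) (n : nat).
Implicit Types (Om U : set (Cn R n)) (rho : Cn R n -> R).

(* For q in pd_nbhd and 0 < r < pd_radius: pd_chart q r, defined on
   pd_dom q r, is the coordinate system centered at q, and pd_tau q r j is the
   j-th polyradius (j = 0 is the complex normal direction). *)
Record polydisc_data := PolydiscData {
  pd_nbhd : set (Cn R n);
  pd_radius : R;
  pd_dom : Cn R n -> R -> set (Cn R n);
  pd_chart : Cn R n -> R -> Cn R n -> Cn R n;
  pd_tau : Cn R n -> R -> 'I_n.+1 -> R }.

Variable P : polydisc_data.

Definition coord_polydisc (q : Cn R n) (r : R) (t : 'I_n.+1 -> R) :=
  [set w | pd_dom P q r w /\ forall j, cabs (pd_chart P q r w 0 j) < t j].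

Definition polydiscD (q : Cn R n) (r : R) := coord_polydisc q r (pd_tau P q r).

(* The polydisc of polyradius t is contained in the coordinate patch and rho
   changes there by no more than r from its value at q. *)
Definition slow_polydisc rho (q : Cn R n) (r : R) (t : 'I_n.+1 -> R) : Prop :=
  (forall x : Cn R n, (forall j, cabs (x 0 j) < t j) ->
     (pd_chart P q r @` pd_dom P q r) x) /\
  (forall w, coord_polydisc q r t w -> `|rho w - rho q| <= r).

(* "Largest" is maximality for inclusion among the polydiscs centered at q in
   the given coordinates. The closed polydisc has to fit in the coordinate
   patch, so that maximality is never caused by the size of the patch. *)
Definition largest_polydisc rho (q : Cn R n) (r : R) : Prop :=
  [/\ forall x : Cn R n, (forall j, cabs (x 0 j) <= pd_tau P q r j) ->
        (pd_chart P q r @` pd_dom P q r) x,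
      slow_polydisc rho q r (pd_tau P q r) &
      forall t, slow_polydisc rho q r t -> (forall j, pd_tau P q r j <= t j) ->
        forall j, t j = pd_tau P q r j].

Definition polydisc_system Om U rho : Prop :=
  [/\ [/\ open (pd_nbhd P), bdry Om `<=` pd_nbhd P & pd_nbhd P `<=` U],
      0 < pd_radius P,
      forall q r, pd_nbhd P q -> 0 < r < pd_radius P ->
        [/\ holo_coords_at (pd_dom P q r) (pd_chart P q r) q,
            pd_dom P q r `<=` U,
            forall j, 0 < pd_tau P q r j,
            pd_tau P q r ord0 = r &
            largest_polydisc rho q r] &
      exists c C : R, 0 < c /\
        forall q r j, pd_nbhd P q -> 0 < r < pd_radius P -> j != ord0 ->
          c * Num.sqrt r <= pd_tau P q r j <= C * Num.sqrt r].

(* B(z,r) = D(z,r) `&` bdry Om for small r; as D(z,r) is only available for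
   r < pd_radius, we put B(z,r) = bdry Om for the other r, which makes the
   quasi-distance finite. *)
Definition bdry_patch Om (z : Cn R n) (r : R) : set (Cn R n) :=
  bdry Om `&` (if r < pd_radius P then polydiscD z r else setT).

Definition qdist Om (z w : Cn R n) : R :=
  inf [set r : R | 0 < r /\ bdry_patch Om z r w].

Definition qball Om (z : Cn R n) (r : R) : set (Cn R n) :=
  [set w | bdry Om w /\ qdist Om z w < r].

End polydiscs.

Section grids.
Variables (R : realType) (n : nat).
Implicit Types (Om U : set (Cn R n)).

Record dyadic_grid Om (P : polydisc_data R n) := DyadicGrid {
  dg_cubes : nat -> set (set (Cn R n));
  dg_center : nat -> set (Cn R n) -> Cn R n;
  dg_C : R;
  dg_delta : R;
  dg_eps : R;
  dg_C_gt0 : 0 < dg_C;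
  dg_delta_itv : 0 < dg_delta < 1;
  dg_eps_itv : 0 < dg_eps < 1;
  dg_borel : forall k Q, (1 <= k)%N -> dg_cubes k Q -> borel Q;
  dg_center_bdry : forall k Q, (1 <= k)%N -> dg_cubes k Q ->
    bdry Om (dg_center k Q);
  dg_cover : forall k, (1 <= k)%N -> bdry Om = \bigcup_(Q in dg_cubes k) Q;
  dg_nested : forall j k Q1 Q2, (1 <= j)%N -> (1 <= k)%N ->
    dg_cubes j Q1 -> dg_cubes k Q2 -> Q1 `&` Q2 !=set0 ->
    Q1 `<=` Q2 \/ Q2 `<=` Q1;
  dg_child : forall k Q, (1 <= k)%N -> dg_cubes k Q ->
    exists2 Q', dg_cubes k.+1 Q' & Q' `<=` Q;
  dg_parent : forall k Q, (1 <= k)%N -> dg_cubes k.+1 Q ->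
    exists! Q', dg_cubes k Q' /\ Q `<=` Q';
  dg_sigma : forall k Q1 Q2, (1 <= k)%N -> dg_cubes k Q1 ->
    dg_cubes k.+1 Q2 -> Q2 `<=` Q1 ->
    (dg_eps%:E * surface_measure Om Q1 <= surface_measure Om Q2)%E;
  dg_balls : forall k Q, (1 <= k)%N -> dg_cubes k Q ->
    qball P Om (dg_center k Q) (dg_delta ^+ k) `<=` Q /\
    Q `<=` qball P Om (dg_center k Q) (dg_C * dg_delta ^+ k) }.

Definition is_nearest (A : set (Cn R n)) (w z : Cn R n) : Prop :=
  A z /\ forall z', A z' -> eucl_dist w z <= eucl_dist w z'.

Definition proj_bdry Om (w : Cn R n) : Cn R n :=
  get [set z | is_nearest (bdry Om) w z].

Definition tube Om (eps0 : R) : set (Cn R n) :=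
  [set w | dist_to (bdry Om) w < eps0].

Definition smooth_projection Om (eps0 : R) : Prop :=
  (forall w, tube Om eps0 w -> exists! z, is_nearest (bdry Om) w z) /\
  smooth_map_on (tube Om eps0) (proj_bdry Om).

(* Membership in the tube states that the projection of w is defined. *)
Definition tent Om (eps0 : R) (Q : set (Cn R n)) (l : R) : set (Cn R n) :=
  [set w | [/\ Om w, tube Om eps0 w, Q (proj_bdry Om w) &
               eucl_dist (proj_bdry Om w) w <= l]].

Definition dyadic_extension Om (P : polydisc_data R n) (D : dyadic_grid Om P)
    (eps0 : R) : set (set (Cn R n)) :=
  [set T | T = Om \/ exists k Q,
     [/\ (1 <= k)%N, dg_cubes D k Q & T = tent Om eps0 Q (dg_delta D ^+ k)]].

End grids.

Section maximal_operator.
Variables (R : realType) (n : nat).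
Implicit Types (f : Cn R n -> R[i]) (E Om : set (Cn R n)).

Definition average f E : \bar R :=
  (((fine (dV E))^-1)%:E * \int[@dV R n]_(z in E) (cabs (f z))%:E)%E.

Definition frac_maximal (T : set (set (Cn R n))) (alpha : R) f (z : Cn R n)
    : \bar R :=
  ereal_sup [set (dV E `^ alpha * average f E)%E |
              E in [set E | T E /\ E z]].

(* The norm of L^p(Om); functions outside of Om are disregarded. *)
Definition Lp_norm Om (p : R) (g : Cn R n -> \bar R) : \bar R :=
  Lnorm (@dV R n) p%:E (g \_ Om).

Definition in_Lp Om (p : R) f : Prop :=
  [/\ @measurable_fun _ _ (LebCn R n) R Om (fun z => complex.Re (f z)),
      @measurable_fun _ _ (LebCn R n) R Om (fun z => complex.Im (f z)) &
      (Lp_norm Om p (fun z => (cabs (f z))%:E) < +oo)%E].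

Definition bounded_Lp_Lq Om (M : (Cn R n -> R[i]) -> Cn R n -> \bar R)
    (p q : R) : Prop :=
  exists C : R, forall f, in_Lp Om p f ->
    @measurable_fun _ _ (LebCn R n) (\bar R) Om (M f) /\
    (Lp_norm Om q (M f) <= C%:E * Lp_norm Om p (fun z => (cabs (f z))%:E))%E.

End maximal_operator.

(* Main.v *)
Require Import Defs.
From HB Require Import structures.
From mathcomp Require Import all_boot all_order all_algebra.
From mathcomp Require Import complex.
From mathcomp Require Import all_classical all_reals all_analysis.
From mathcomp Require Import measurable_realfun lra ring.

Set Implicit Arguments.
Unset Strict Implicit.
Unset Printing Implicit Defensive.

Import Order.TTheory GRing.Theory Num.Theory.
Import numFieldNormedType.Exports.

Local Open Scope classical_set_scope.
Local Open Scope ring_scope.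

(** The boundedness is a theorem about dyadic maximal functions on a measure
    space; complex geometry only has to provide a countable family of
    measurable sets, contained in a set of finite measure and such that two
    members that meet are nested (a laminar family).

    Let T be such a family, <F>_E the mean of F >= 0 over E, and N a positive
    bound of the L^p norm of F.  For E of measure v, Hoelder's inequality
    gives <F>_E <= 2 N v^(-1/p) (the factor 2 pays for a pointwise proof).
    Since alpha p + p/q = 1, splitting <F>_E into the powers of exponents
    alpha p and p/q yields
      v^alpha <F>_E <= (2N)^(alpha p) <F>_E^(p/q),
    so that large fractional averages force large plain averages.  If
    <F>_E > 2t, then removing the part of F below t leaves
    v <= 1/t times the integral of F 1_(F > t) over E ([frac_average_gt]).
    In a laminar family the union of finitely many sets is the disjoint union
    of the maximal ones, so this inequality passes from the members to their
    union ([laminar_measure_le]).  This is a weak-type estimate for the super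
    level sets of the maximal function at the heights
    s(t) = (2N)^(alpha p) (2t)^(p/q) ([frac_sup_weak]).

    Summing it over t = 2^k a for k >= 0, as in the proof of Marcinkiewicz'
    theorem, leaves a geometric series that is bounded by a constant times
    F^p ([frac_sup_strong]).  Starting at a = N V^(-1/p), where V bounds the
    measure of the domain, is harmless: the part of the maximal function
    below s(a) contributes at most a constant times N^q.

    It remains to see that the tents form such a family.  They are Lebesgue
    measurable because the projection onto the boundary is continuous on the
    tube and open sets are Caratheodory measurable for the outer measure
    given by boxes.  Cubes of one generation that meet are nested, and then
    equal because a child of the smaller one has only one parent; hence two
    tents that meet come from an ancestor and a descendant and are nested
    ([tents_nested]).  Cubes of one generation are thus disjoint sets with
    nonempty relative interior in the boundary, so there are countably many
    of them ([cubes_countable]). *)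

(** * Elementary inequalities *)

Lemma ex_expr2_gt (R : realType) (x : R) : exists m, x < 2 ^+ m.
Proof.
exists (Num.truncn x).+1; rewrite (lt_trans (truncnS_gt x))// -natrX ltr_nat.
exact: ltn_expl.
Qed.

Section real_inequalities.
Variable R : realType.
Implicit Types (x l p : R).

(** A pointwise substitute for Hoelder's inequality: integrated over a set of
    measure v, with a suitable [l], it bounds the integral of [x] by the L^p
    norm. *)
Lemma le_add_powR x l p : 0 <= x -> 0 < l -> 1 < p ->
  x <= l + l `^ (1 - p) * x `^ p.
Proof.
move=> x0 l0 p1; have [xl|lx] := leP x l.
  by rewrite (le_trans xl)// lerDl mulr_ge0 ?powR_ge0.
have x0' : 0 < x by rewrite (lt_trans l0).
rewrite (@le_trans _ _ (l `^ (1 - p) * x `^ p))//; last by rewrite lerDr ltW.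
rewrite -(@mulr_powRB1 _ x p)//; last by rewrite (lt_trans ltr01).
rewrite mulrCA ler_peMr// -opprB powRN mulrC ler_pdivlMr ?powR_gt0// mul1r.
by rewrite ge0_ler_powR ?nnegrE ?(ltW l0) ?(ltW x0') ?(ltW lx)// subr_ge0 ltW.
Qed.

(** The summands below the threshold form a geometric progression of ratio
    2^(p-1) > 1, hence add up to at most a constant times the last of them. *)
Lemma sum_dyadic_powR_le x a p k : 0 <= x -> 0 < a -> 1 < p ->
  \sum_(0 <= i < k) (2 ^+ i * a) `^ (p - 1) * (2 ^+ i * a < x)%R%:R <=
  2 `^ (p - 1) / (2 `^ (p - 1) - 1) * x `^ (p - 1).
Proof.
move=> x0 a0 p1.
have p10 : 0 < p - 1 by rewrite subr_gt0.
set b := 2 `^ (p - 1).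
have b1 : 1 < b.
  apply: (@le_lt_trans _ _ (1 `^ (p - 1))); first by rewrite powR1.
  by rewrite gt0_ltr_powR ?nnegrE ?ltr1n.
have b10 : 0 < b - 1 by rewrite subr_gt0.
have bge : 0 <= b / (b - 1) by rewrite divr_ge0 ?powR_ge0// ltW.
elim: k => [|k IH]; first by rewrite big_nil mulr_ge0 ?powR_ge0.
have [xk|xk] := ltP (2 ^+ k * a) x; last first.
  by rewrite big_nat_recr//= ltNge xk/= mulr0 addr0.
have E i : (2 ^+ i * a) `^ (p - 1) = b ^+ i * a `^ (p - 1).
  rewrite powRM ?exprn_ge0 ?(ltW a0)//; congr (_ * _).
  by rewrite -(@powR_mulrn _ 2 i)// powRAC powR_mulrn ?powR_ge0.
apply: (@le_trans _ _ (b / (b - 1) * (2 ^+ k * a) `^ (p - 1))); last first.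
  rewrite ler_wpM2l// ge0_ler_powR ?nnegrE ?(ltW xk) ?(ltW p10)//.
  by rewrite mulr_ge0 ?exprn_ge0// ltW.
apply: (@le_trans _ _ (\sum_(0 <= i < k.+1) b ^+ i * a `^ (p - 1))).
  apply: ler_sum => i _; rewrite E ler_piMr ?mulr_ge0 ?exprn_ge0 ?powR_ge0//.
  by case: (_ < _).
rewrite -mulr_suml E mulrA ler_wpM2r ?powR_ge0//.
rewrite mulrAC ler_pdivlMr// mulrC big_mkord -subrX1 exprS.
by rewrite lerBlDr lerDl.
Qed.

End real_inequalities.

Lemma nneseries_ge_term (R : realType) (u : (\bar R)^nat) k :
  (forall i, 0 <= u i)%E -> (u k <= \sum_(i <oo) u i)%E.
Proof.
move=> u0; apply: le_trans (@nneseries_lim_ge _ u xpredT 0%N k.+1 _).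
  by rewrite big_nat_recr//= leeDr// sume_ge0.
by move=> *; exact: u0.
Qed.

(** A layer-cake estimate: if [y] exceeds [s 0], it lies between two
    consecutive heights, and the corresponding term of the series is already
    large enough; if [y] is infinite, the terms are unbounded. *)
Lemma poweR_le_layers (R : realType) (s : nat -> R) (q : R) (y : \bar R) :
  0 < q -> (forall k, 0 <= s k) -> (forall M, exists k, M <= s k) ->
  (0 <= y)%E ->
  (y `^ q <= ((s 0%N) `^ q)%:E +
    \sum_(k <oo) ((s k.+1) `^ q * ((s k)%:E < y)%E%:R)%:E)%E.
Proof.
move=> q0 s0 soo y0.
have u0 k : (0 <= ((s k.+1) `^ q * ((s k)%:E < y)%E%:R)%:E)%E.
  by rewrite lee_fin mulr_ge0 ?powR_ge0.
have S0 : (0 <= \sum_(k <oo) ((s k.+1) `^ q * ((s k)%:E < y)%E%:R)%:E)%E.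
  by apply: nneseries_ge0 => k _ _.
case: y y0 u0 S0 => [y| |]//; last first.
  move=> _ u0 S0; rewrite poweRyr ?gt_eqF//.
  apply: le_trans (leeDr _ _); last by rewrite lee_fin powR_ge0.
  rewrite leye_eq; apply/eqP/eqyP => M M0.
  have [k Mk] := soo (Num.max (M `^ q^-1) (s 0%N + 1)).
  case: k Mk => [|k]; first by rewrite ge_max gerDl ler10 andbF.
  rewrite ge_max => /andP[Mk _].
  apply: le_trans (@nneseries_ge_term _ _ k u0).
  rewrite ltry mulr1 lee_fin -(@powRr1 _ M) ?(ltW M0)//.
  rewrite -(@mulVf _ q) ?gt_eqF// powRrM.
  by rewrite ge0_ler_powR ?nnegrE ?powR_ge0 ?(ltW q0).
rewrite lee_fin => y0 u0 S0; rewrite poweR_EFin.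
have [ys|sy] := leP y (s 0%N).
  apply: le_trans (leeDl _ S0).
  by rewrite lee_fin ge0_ler_powR ?nnegrE ?(ltW q0).
apply: le_trans (leeDr _ _); last by rewrite lee_fin powR_ge0.
have [k yk ymin] : exists2 k, y <= s k & forall j, y <= s j -> (k <= j)%N.
  have ex : exists k, y <= s k by exact: soo.
  by exists (ex_minn ex); case: ex_minnP.
case: k yk ymin => [|k] yk ymin; first by rewrite ltNge yk in sy.
have sk : s k < y by rewrite ltNge; apply/negP => /ymin; rewrite ltnn.
apply: le_trans (@nneseries_ge_term _ _ k u0).
by rewrite lte_fin sk mulr1 lee_fin ge0_ler_powR ?nnegrE ?(ltW q0).
Qed.

(** * Laminar families *)

Definition laminar T (S : set (set T)) := forall A B, S A -> S B ->
  A `&` B !=set0 -> A `<=` B \/ B `<=` A.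

Section laminar.
Local Open Scope ereal_scope.
Context d (T : measurableType d) (R : realType).
Variables (mu : {measure set T -> \bar R}) (D : set T) (h : T -> \bar R).
Hypothesis mD : measurable D.
Hypothesis mh : measurable_fun D h.
Hypothesis h0 : forall x, D x -> 0 <= h x.
Variable E : nat -> set T.
Hypothesis mE : forall i, measurable (E i).
Hypothesis ED : forall i, E i `<=` D.
Hypothesis lamE : laminar (range E).
Hypothesis muE : forall i, mu (E i) <= \int[mu]_(x in E i) h x.

(** One set [E i] is added at a time: either it is contained in an earlier
    set, or it absorbs the sets that it contains and is disjoint from the
    others. *)
Lemma laminar_measure_le_finite (s : seq nat) :
  mu (\bigcup_(i in [set` s]) E i) <=
  \int[mu]_(x in \bigcup_(i in [set` s]) E i) h x.
Proof.
have [m] := ubnP (size s); elim: m s => // m IH [|i s] /= sm.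
  rewrite (_ : [set` [::]] = set0) ?bigcup_set0 ?measure0 ?integral_set0//.
  by apply/seteqP; split => x.
have mU (r : seq nat) : measurable (\bigcup_(j in [set` r]) E j).
  by rewrite bigcup_seq; exact: bigsetU_measurable.
have UD (r : seq nat) : \bigcup_(j in [set` r]) E j `<=` D.
  by move=> x [j _ Ex]; exact: (ED Ex).
have [[j js Eij]|noj] := pselect (exists2 j, j \in s & E i `<=` E j).
  rewrite (_ : \bigcup_(_ in _) _ = \bigcup_(j in [set` s]) E j).
    exact: IH.
  apply/seteqP; split => x [k /= ks Ekx]; last first.
    by exists k => //=; rewrite inE ks orbT.
  by move: ks Ekx; rewrite inE => /predU1P[->/Eij Ex|ks Ekx];
    [exists j|exists k].
(* The indices of the sets that are not absorbed by [E i]. *)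
pose r := [seq j <- s | ~~ `[< E j `<=` E i >]].
have UE : \bigcup_(j in [set` i :: s]) E j =
          E i `|` \bigcup_(j in [set` r]) E j.
  apply/seteqP; split => x.
    move=> [k /= ks Ekx]; have [Eki|Eki] := pselect (E k `<=` E i).
      by left; exact: Eki.
    move: ks Eki Ekx; rewrite inE => /predU1P[-> []//|ks Eki Ekx].
    by right; exists k => //=; rewrite mem_filter ks andbT; exact/asboolPn.
  case=> [Eix|[k /=]]; first by exists i => //=; rewrite inE eqxx.
  by rewrite mem_filter => /andP[_ ks] Ekx; exists k => //=; rewrite inE ks orbT.
have dis : [disjoint E i & \bigcup_(j in [set` r]) E j].
  rewrite disj_set2E; apply/eqP; rewrite -subset0 => x [Eix [k /=]].
  rewrite mem_filter => /andP[/asboolPn Eki ks] Ekx.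
  have [||| Eik|//] := @lamE (E i) (E k); [by exists i|by exists k|by exists x|].
  by apply: noj; exists k.
rewrite UE (ge0_integral_setU mu (mE i) (mU r))//; last 2 first.
- by apply: measurable_funS mh => //; rewrite subUset; split=> //; exact: ED.
- by move=> x [/ED|/UD] /h0.
rewrite (le_trans (measureU2 mu (mE i) (mU r)))// leeD//.
  exact: muE.
apply: IH; rewrite (leq_ltn_trans _ (sm : size s < m)%N)//=.
by rewrite size_filter count_size.
Qed.

Lemma laminar_measure_le :
  mu (\bigcup_i E i) <= \int[mu]_(x in D) h x.
Proof.
pose U n := \bigcup_(i in [set` iota 0 n]) E i.
have mU n : measurable (U n).
  by rewrite /U bigcup_seq; exact: bigsetU_measurable.
have ndU : nondecreasing_seq U.
  move=> m n mn; apply/subsetPset => x [i /=].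
  rewrite mem_iota add0n => /andP[_ im] Ex.
  by exists i => //=; rewrite mem_iota add0n/= (leq_trans im).
have UE : \bigcup_n U n = \bigcup_i E i.
  apply/seteqP; split => x [n _]; first by case=> i _ Ex; exists i.
  move=> Ex; exists n.+1 => //; exists n => //.
  by change (n \in iota 0 n.+1); rewrite mem_iota add0n leqnn.
have mUE : measurable (\bigcup_n U n) by exact: bigcupT_measurable.
have cU := nondecreasing_cvg_mu (mu := mu) mU mUE ndU.
rewrite -UE -(cvg_lim _ cU)//; apply: lime_le.
  by apply/cvg_ex; eexists; exact: cU.
apply: nearW => n /=; rewrite (le_trans (laminar_measure_le_finite _))//.
apply: ge0_subset_integral => //; first exact: mU.
by move=> x [i _ /ED].
Qed.

End laminar.

(** * Fractional averages *)

Section averages.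
Context d (T : measurableType d) (R : realType).
Variables (mu : {measure set T -> \bar R}) (F : T -> R).
Variables (D : set T) (mD : measurable D).
Hypothesis mF : measurable_fun D F.
Hypothesis F0 : forall x, 0 <= F x.

Definition frac_average (alpha : R) (E : set T) : \bar R :=
  (mu E `^ alpha * ((fine (mu E))^-1%:E * \int[mu]_(x in E) (F x)%:E))%E.

Definition trunc_above (t : R) (x : T) : R := F x * (t < F x)%R%:R.

Lemma trunc_above_ge0 t x : 0 <= trunc_above t x.
Proof. by rewrite mulr_ge0. Qed.

Lemma measurable_trunc_above t : measurable_fun D (trunc_above t).
Proof.
apply: measurable_funM => //.
have mI : measurable_fun setT (\1_`]t, +oo[%classic : R -> R).
  by apply: measurable_indic; exact: measurable_itv.
have := measurableT_comp mI mF; congr measurable_fun; apply/funext => x /=.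
by rewrite indicE mem_setE in_itv/= andbT.
Qed.

Variables (p N : R).
Hypothesis p1 : 1 < p.
Hypothesis N0 : 0 < N.
Hypothesis FN : (\int[mu]_(x in D) (F x `^ p)%:E <= (N `^ p)%:E)%E.

Lemma integral_le_powR (E : set T) (v : R) : measurable E -> E `<=` D ->
  mu E = v%:E -> 0 < v ->
  (\int[mu]_(x in E) (F x)%:E <= (2 * N * v `^ (1 - p^-1))%:E)%E.
Proof.
move=> mE ED muE v0.
have p0 : 0 < p by rewrite (lt_trans ltr01).
(* The level at which the two terms of [le_add_powR] have equal integrals. *)
pose l := N * v `^ (- p^-1).
have l0 : 0 < l by rewrite mulr_gt0 ?powR_gt0.
have mFE : measurable_fun E (fun x => (F x)%:E).
  by apply/measurable_EFinP; exact: measurable_funS mF.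
have mFpE : measurable_fun E (fun x => (F x `^ p)%:E).
  apply/measurable_EFinP; apply: measurableT_comp (measurable_powR p) _.
  exact: measurable_funS mF.
apply: (@le_trans _ _
    (\int[mu]_(x in E) (l%:E + (l `^ (1 - p))%:E * (F x `^ p)%:E))%E).
  apply: ge0_le_integral => //.
  - by move=> x _; rewrite lee_fin.
  - apply: emeasurable_funD => //; exact: measurable_funeM.
  - by move=> x _; rewrite -EFinM -EFinD lee_fin le_add_powR.
rewrite ge0_integralD//; last 3 first.
- by move=> x _; rewrite lee_fin ltW.
- by move=> x _; rewrite -EFinM lee_fin mulr_ge0 ?powR_ge0.
- exact: measurable_funeM.
rewrite integral_cst// muE ge0_integralZl//; last 2 first.
- by move=> x _; rewrite lee_fin powR_ge0.
- by rewrite lee_fin powR_ge0.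
apply: (@le_trans _ _ (l%:E * v%:E + (l `^ (1 - p))%:E * (N `^ p)%:E)%E).
  apply: leeD => //; apply: lee_wpmul2l; first by rewrite lee_fin powR_ge0.
  apply: le_trans FN; apply: ge0_subset_integral => //.
    by apply/measurable_EFinP; exact: measurableT_comp (measurable_powR p) mF.
  by move=> x _; rewrite lee_fin powR_ge0.
rewrite -!EFinM -EFinD lee_fin.
have -> : l * v = N * v `^ (1 - p^-1).
  by rewrite /l -mulrA -{2}(powRr1 (ltW v0)) -powRD ?(gt_eqF v0) ?implybT// addrC.
have -> : l `^ (1 - p) * N `^ p = N * v `^ (1 - p^-1).
  rewrite /l powRM ?(ltW N0) ?powR_ge0// -powRrM mulrAC -powRD; last first.
    by rewrite (gt_eqF N0) implybT.
  rewrite subrK powRr1 ?(ltW N0)//; congr (_ * _ `^ _).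
  by field; rewrite gt_eqF.
lra.
Qed.

Variables (q alpha : R).
Hypothesis pq : p < q.
Hypothesis alphaE : alpha = p^-1 - q^-1.

(** By [integral_le_powR] the hypothesis forces the mean of [F] over [E] to
    exceed [2 * t], and the values of [F] below [t] account for at most half
    of that. *)
Lemma frac_average_gt (E : set T) (t : R) : measurable E -> E `<=` D ->
  (mu E < +oo)%E -> 0 < t ->
  (((2 * N) `^ (alpha * p) * (2 * t) `^ (p / q))%:E < frac_average alpha E ->
   mu E <= \int[mu]_(x in E) (t^-1%:E * (trunc_above t x)%:E))%E.
Proof.
move=> mE ED muoo t0.
have p0 : 0 < p by rewrite (lt_trans ltr01).
have q0 : 0 < q by rewrite (lt_trans p0).
have [v muE] : exists v, mu E = v%:E.
  by exists (fine (mu E)); rewrite fineK// ge0_fin_numE.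
have : 0 <= v by rewrite -lee_fin -muE.
rewrite le_eqVlt => /predU1P[v0|v0].
  rewrite /frac_average muE -v0/= invr0 mul0e mule0 lte_fin ltNge.
  by rewrite mulr_ge0 ?powR_ge0.
have IN := integral_le_powR mE ED muE v0.
have I0 : (0 <= \int[mu]_(x in E) (F x)%:E)%E.
  by apply: integral_ge0 => x _; rewrite lee_fin.
have [I IE] : exists I, (\int[mu]_(x in E) (F x)%:E = I%:E)%E.
  exists (fine (\int[mu]_(x in E) (F x)%:E)%E).
  by rewrite fineK// ge0_fin_numE// (le_lt_trans IN) ?ltry.
rewrite IE in IN I0; rewrite !lee_fin in IN I0.
rewrite /frac_average muE [fine _]/= poweR_EFin IE -!EFinM lte_fin => sI.
have tvI : 2 * t * v < I.
  rewrite ltNge; apply/negP => Itv; move: sI; apply/negP; rewrite -leNgt.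
  (* The mean is split into powers of exponents alpha p and p / q. *)
  have ap : alpha * p + p / q = 1.
    by rewrite alphaE; field; rewrite !gt_eqF.
  have ap0 : 0 <= alpha * p.
    rewrite alphaE mulr_ge0 ?(ltW p0)// subr_ge0 ler_pV2 ?inE ?unitfE ?gt_eqF//.
    exact: ltW.
  have m0 : 0 <= v^-1 * I by rewrite mulr_ge0// invr_ge0 ltW.
  move mE' : (v^-1 * I) => m in m0 *.
  have -> : v `^ alpha * m =
      (v `^ p^-1 * m) `^ (alpha * p) * m `^ (p / q).
    rewrite powRM ?powR_ge0// -mulrA -powRD ?ap ?oner_eq0// powRr1// -powRrM.
    by rewrite mulrCA mulVf ?gt_eqF// mulr1.
  apply: ler_pM; rewrite ?powR_ge0//.
    apply: ge0_ler_powR => //; rewrite ?nnegrE.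
    - by rewrite mulr_ge0// powR_ge0.
    - by rewrite mulr_ge0// ltW.
    rewrite -mE' mulrA -(powR_inv1 (ltW v0)) -powRD ?(gt_eqF v0) ?implybT//.
    rewrite (_ : p^-1 + -1 = - (1 - p^-1)); last by ring.
    by rewrite powRN mulrC ler_pdivrMr ?powR_gt0.
  apply: ge0_ler_powR; rewrite ?nnegrE//.
  - by rewrite divr_ge0// ltW.
  - by rewrite mulr_ge0// ltW.
  by rewrite -mE' mulrC ler_pdivrMr.
have mFE : measurable_fun E (fun x => (F x)%:E).
  by apply/measurable_EFinP; exact: measurable_funS mF.
have mtE : measurable_fun E (fun x => (trunc_above t x)%:E).
  apply/measurable_EFinP; exact: measurable_funS (measurable_trunc_above t).
rewrite ge0_integralZl//; last 2 first.
- by move=> x _; rewrite lee_fin trunc_above_ge0.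
- by rewrite lee_fin invr_ge0 ltW.
have : (I%:E <= (t * v)%:E + \int[mu]_(x in E) (trunc_above t x)%:E)%E.
  rewrite -IE EFinM -muE -integral_cst// -ge0_integralD//; last 2 first.
  - by move=> x _; rewrite lee_fin ltW.
  - by move=> x _; rewrite lee_fin trunc_above_ge0.
  apply: ge0_le_integral => //.
  - by move=> x _; rewrite lee_fin.
  - exact: emeasurable_funD.
  - move=> x _; rewrite -EFinD lee_fin /trunc_above.
    by case: ltP => [_|xt]; rewrite ?mulr1 ?mulr0 ?addr0// lerDr ltW.
have : (0 <= \int[mu]_(x in E) (trunc_above t x)%:E)%E.
  by apply: integral_ge0 => x _; rewrite lee_fin trunc_above_ge0.
case: (\int[mu]_(x in E) _)%E => [J| |]//=; last first.
  by move=> _ _; rewrite mulry gtr0_sg ?invr_gt0// mul1e leey.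
rewrite -EFinD -EFinM !lee_fin => _ IJ.
by rewrite mulrC ler_pdivlMr//; lra.
Qed.

End averages.

(** * The maximal operator of a laminar family *)

Lemma countable_range T (S : set T) (x0 : T) : countable S -> S x0 ->
  exists e : nat -> T, range e = S.
Proof.
move=> /countable_injP[f injf] Sx0.
pose P n x := S x /\ f x = n.
exists (fun n => if pselect (exists x, P n x) is left ex
                 then projT1 (cid ex) else x0).
apply/seteqP; split => [_ [n _ <-]|x Sx].
  by case: pselect => // ex; case: cid => x [].
exists (f x) => //; case: pselect => [ex|[]]; last by exists x.
case: cid => y [Sy fyx] /=; apply: injf; rewrite ?inE//.
Qed.

Section maximal.
Context d (T : measurableType d) (R : realType).
Variables (mu : {measure set T -> \bar R}) (F : T -> R).
Variables (D : set T) (V : R).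
Hypothesis mD : measurable D.
Hypothesis V0 : 0 < V.
Hypothesis DV : (mu D <= V%:E)%E.
Hypothesis mF : measurable_fun D F.
Hypothesis F0 : forall x, 0 <= F x.
Variable S : set (set T).
Hypothesis cS : countable S.
Hypothesis SD : S D.
Hypothesis mS : forall A, S A -> measurable A /\ A `<=` D.
Hypothesis lamS : laminar S.

Definition frac_sup (alpha : R) (x : T) : \bar R :=
  ereal_sup [set frac_average mu F alpha A | A in [set A | S A /\ A x]].

(** Super level sets are unions of a sequence of members of the family; the
    empty set stands for the members whose average is too small. *)
Lemma frac_sup_level alpha (s : \bar R) : exists E : nat -> set T,
  (forall i, E i = set0 \/ S (E i) /\ (s < frac_average mu F alpha (E i))%E) /\
  D `&` [set x | (s < frac_sup alpha x)%E] = \bigcup_i E i.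
Proof.
have [e eS] := countable_range cS SD.
exists (fun i => if (s < frac_average mu F alpha (e i))%E then e i else set0).
split.
  move=> i; case: ifPn => se; [right|by left]; split => //.
  by rewrite -eS; exists i.
apply/seteqP; split => x.
  move=> [Dx /= /ereal_sup_gt[_ [A [SA Ax] <-] sA]].
  by move: SA; rewrite -eS => -[i _ eA]; exists i => //; rewrite eA sA.
move=> [i _]; case: ifPn => // se ex.
have Sei : S (e i) by rewrite -eS; exists i.
split; first exact: (mS Sei).2.
by apply: (lt_le_trans se); apply: ereal_sup_ubound; exists (e i).
Qed.

Lemma measurable_frac_sup alpha : measurable_fun D (frac_sup alpha).
Proof.
move=> _; apply: (measurability _ (ErealGenOInfty.measurableE R)) => //.
move=> _ [_ [s ->] <-]; rewrite preimage_itvoy.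
have [E [SE ->]] := frac_sup_level alpha s%:E.
apply: bigcupT_measurable => i.
by have [->//|[/mS[]]] := SE i.
Qed.

Lemma frac_sup_ge0 alpha x : D x -> (0 <= frac_sup alpha x)%E.
Proof.
move=> Dx; apply: (@le_trans _ _ (frac_average mu F alpha D)).
  rewrite mule_ge0 ?poweR_ge0// mule_ge0 ?lee_fin ?invr_ge0 ?fine_ge0//.
  by apply: integral_ge0 => y _; rewrite lee_fin.
by apply: ereal_sup_ubound; exists D.
Qed.

Variables (p q alpha : R).
Hypothesis p1 : 1 < p.
Hypothesis pq : p < q.
Hypothesis alphaE : alpha = p^-1 - q^-1.

Section bound.
Variable N : R.
Hypothesis N0 : 0 < N.
Hypothesis FN : (\int[mu]_(x in D) (F x `^ p)%:E <= (N `^ p)%:E)%E.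

Lemma frac_sup_weak t : 0 < t ->
  (mu (D `&` [set x | ((2 * N) `^ (alpha * p) * (2 * t) `^ (p / q))%:E
                      < frac_sup alpha x]%E) <=
   \int[mu]_(x in D) (t^-1%:E * (trunc_above F t x)%:E))%E.
Proof.
move=> t0.
have [E [SE ->]] := frac_sup_level alpha
  ((2 * N) `^ (alpha * p) * (2 * t) `^ (p / q))%:E.
have mtr : measurable_fun D (fun x => t^-1%:E * (trunc_above F t x)%:E)%E.
  apply: measurable_funeM; apply/measurable_EFinP; exact: measurable_trunc_above.
have mE i : measurable (E i) by have [->//|[/mS[]]] := SE i.
have ED i : E i `<=` D by have [->//|[/mS[]]] := SE i.
apply: laminar_measure_le => //.
- by move=> x _; rewrite -EFinM lee_fin mulr_ge0 ?trunc_above_ge0 ?invr_ge0 ?ltW.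
- move=> _ _ [i _ <-] [j _ <-] [x [Eix Ejx]].
  have [Ei0|[Si _]] := SE i; first by rewrite Ei0 in Eix.
  have [Ej0|[Sj _]] := SE j; first by rewrite Ej0 in Ejx.
  by apply: lamS => //; exists x.
- move=> i; have [->|[_ si]] := SE i; first by rewrite measure0 integral_set0.
  have := @frac_average_gt _ _ _ mu F D mD mF F0 p N p1 N0 FN q alpha pq alphaE.
  apply => //.
  apply: (@le_lt_trans _ _ (mu D)); first by apply: le_measure; rewrite ?inE.
  by rewrite (le_lt_trans DV) ?ltry.
Qed.

(** The two summands come from the part of the maximal function below the
    first height and from the geometric series. *)
Definition frac_sup_cst : R :=
  2 `^ (q - p) * (2 `^ p + 4 `^ p * (2 `^ (p - 1) / (2 `^ (p - 1) - 1))).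

Lemma frac_sup_cst_ge0 : 0 <= frac_sup_cst.
Proof.
rewrite mulr_ge0 ?addr_ge0 ?mulr_ge0 ?powR_ge0// invr_ge0 subr_ge0.
rewrite (@le_trans _ _ (1 `^ (p - 1)))//; first by rewrite powR1.
by rewrite ge0_ler_powR ?nnegrE ?ler1n// subr_ge0 ltW.
Qed.

(** The heights [s k] are chosen so that [frac_sup_weak] applies with
    [t k = 2 ^+ k * a], and the first one so that [a `^ p * V = N `^ p]. *)
Lemma frac_sup_strong :
  (\int[mu]_(x in D) (frac_sup alpha x `^ q) <= (frac_sup_cst * N `^ q)%:E)%E.
Proof.
have p0 : 0 < p by rewrite (lt_trans ltr01).
have q0 : 0 < q by rewrite (lt_trans p0).
have p10 : 0 < p - 1 by rewrite subr_gt0.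
pose a := N * V `^ (- p^-1).
have a0 : 0 < a by rewrite mulr_gt0 ?powR_gt0.
pose t k := 2 ^+ k * a.
have t0 k : 0 < t k by rewrite mulr_gt0 ?exprn_gt0.
pose s k := (2 * N) `^ (alpha * p) * (2 * t k) `^ (p / q).
have s0 k : 0 <= s k by rewrite mulr_ge0 ?powR_ge0.
have sq k : s k `^ q = (2 * N) `^ (q - p) * (2 * t k) `^ p.
  rewrite /s (powRM _ (powR_ge0 _ _) (powR_ge0 _ _)) -!powRrM.
  congr (_ `^ _ * _ `^ _).
    by rewrite alphaE; field; rewrite !gt_eqF.
  by rewrite mulfVK ?gt_eqF.
have soo M : exists k, M <= s k.
  have pq0 : 0 < p / q by rewrite divr_gt0.
  pose c := (2 * N) `^ (alpha * p).
  have c0 : 0 < c by apply: powR_gt0; rewrite mulr_gt0.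
  pose M' := Num.max M 1.
  have M'0 : 0 < M' by rewrite lt_max ltr01 orbT.
  pose y := (M' / c) `^ (p / q)^-1 / a.
  have [k yk] := ex_expr2_gt y.
  exists k; apply: (@le_trans _ _ M'); first by rewrite le_max lexx.
  rewrite /s -/c mulrC -ler_pdivrMr//.
  have -> : M' / c = ((M' / c) `^ (p / q)^-1) `^ (p / q).
    by rewrite -powRrM mulVf ?gt_eqF// powRr1 ?divr_ge0 ?ltW.
  apply: ge0_ler_powR; rewrite ?nnegrE ?powR_ge0//; first exact: ltW.
    by rewrite mulr_ge0// ltW.
  rewrite mulrA -ler_pdivrMr// -/y -exprS (le_trans (ltW yk))//.
  by rewrite ler_eXn2l// ltr1n.
have mM := measurable_frac_sup alpha.
have mMk k : measurable (D `&` [set x | (s k)%:E < frac_sup alpha x]%E).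
  exact: emeasurable_fun_o_infty.
pose I k x : \bar R := ((s k.+1) `^ q * ((s k)%:E < frac_sup alpha x)%E%:R)%:E.
have I0 k x : (0 <= I k x)%E by rewrite lee_fin mulr_ge0 ?powR_ge0.
have IE k : {in D, I k =1 fun x => ((s k.+1) `^ q)%:E *
    (\1_(D `&` [set x | (s k)%:E < frac_sup alpha x]%E) x)%:E}%E.
  move=> x xD; rewrite /I indicE in_setI xD/= -EFinM.
  congr (_ * (nat_of_bool _)%:R)%:E.
  by apply/idP/idP; rewrite inE.
have mI k : measurable_fun D (I k).
  apply: (@eq_measurable_fun _ _ _ _ _ (fun x => ((s k.+1) `^ q)%:E *
    (\1_(D `&` [set x | (s k)%:E < frac_sup alpha x]%E) x)%:E)%E).
    by move=> x xD; rewrite IE.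
  apply: measurable_funeM; apply/measurable_EFinP; exact: measurable_indic.
have mSum : measurable_fun D (fun x => \sum_(k <oo) I k x)%E.
  exact: ge0_emeasurable_sum.
apply: (@le_trans _ _ (\int[mu]_(x in D) (((s 0%N) `^ q)%:E +
    \sum_(k <oo) I k x))%E).
  apply: ge0_le_integral => //.
  - by move=> x _; exact: poweR_ge0.
  - exact: measurableT_comp (measurable_poweR q) mM.
  - exact: emeasurable_funD.
  - move=> x Dx; apply: poweR_le_layers => //; exact: frac_sup_ge0.
rewrite ge0_integralD//; last 2 first.
- by move=> x _; rewrite lee_fin powR_ge0.
- by move=> x _; apply: nneseries_ge0.
rewrite integral_cst// integral_nneseries//.
set b := 2 `^ (p - 1) / (2 `^ (p - 1) - 1).
have mtr k : measurable_fun D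
    (fun x => (t k)^-1%:E * (trunc_above F (t k) x)%:E)%E.
  apply: measurable_funeM; apply/measurable_EFinP; exact: measurable_trunc_above.
have tr0 k x : (0 <= (t k)^-1%:E * (trunc_above F (t k) x)%:E)%E.
  by rewrite -EFinM lee_fin mulr_ge0 ?trunc_above_ge0 ?invr_ge0 ?ltW.
pose J k x :=
  (((s k.+1) `^ q)%:E * ((t k)^-1%:E * (trunc_above F (t k) x)%:E))%E.
have mJ k : measurable_fun D (J k) by exact: measurable_funeM.
have J0 k x : (0 <= J k x)%E by rewrite mule_ge0// lee_fin powR_ge0.
have IJ k : (\int[mu]_(x in D) I k x <= \int[mu]_(x in D) J k x)%E.
  rewrite (eq_integral (fun x => ((s k.+1) `^ q)%:E *
    (\1_(D `&` [set x | (s k)%:E < frac_sup alpha x]%E) x)%:E)%E); last first.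
    by move=> x xD; rewrite IE.
  rewrite ge0_integralZl ?lee_fin ?powR_ge0//; last 1 first.
    by apply/measurable_EFinP; exact: measurable_indic.
  rewrite [leRHS]ge0_integralZl ?lee_fin ?powR_ge0//.
  apply: lee_wpmul2l; first by rewrite lee_fin powR_ge0.
  rewrite integral_indic// setIAC setIid; exact: frac_sup_weak.
apply: (@le_trans _ _ (((s 0%N) `^ q)%:E * V%:E +
    \int[mu]_(x in D) \sum_(k <oo) J k x)%E).
  apply: leeD; first by apply: lee_wpmul2l => //; rewrite lee_fin powR_ge0.
  rewrite integral_nneseries//; apply: lee_nneseries => // k _ _.
  exact: integral_ge0.
pose K := (2 * N) `^ (q - p) * 4 `^ p * b.
have K0 : 0 <= K.
  rewrite !mulr_ge0 ?powR_ge0// invr_ge0 subr_ge0.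
  apply: (@le_trans _ _ (1 `^ (p - 1))); first by rewrite powR1.
  by rewrite ge0_ler_powR ?nnegrE ?ler1n// ltW.
have JK x : (\sum_(k <oo) J k x <= K%:E * (F x `^ p)%:E)%E.
  apply: lime_le; first by apply: is_cvg_nneseries.
  apply: nearW => k; rewrite /J.
  under eq_bigr do rewrite -!EFinM.
  rewrite sumEFin -EFinM lee_fin.
  have -> : \sum_(0 <= i < k) s i.+1 `^ q * ((t i)^-1 * trunc_above F (t i) x) =
      (2 * N) `^ (q - p) * 4 `^ p * F x *
      \sum_(0 <= i < k) (2 ^+ i * a) `^ (p - 1) * (2 ^+ i * a < F x)%R%:R.
    rewrite big_distrr/=; apply: eq_bigr => i _.
    rewrite sq -/(t i) (_ : 2 * t i.+1 = 4 * t i); last by rewrite /t exprS; ring.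
    rewrite (powRM p (ler0n _ 4) (ltW (t0 i))) /trunc_above.
    rewrite -(@mulr_powRB1 _ (t i) p) ?(ltW (t0 i))//.
    by field; rewrite gt_eqF.
  apply: (@le_trans _ _
      ((2 * N) `^ (q - p) * 4 `^ p * F x * (b * F x `^ (p - 1)))).
    rewrite ler_wpM2l ?mulr_ge0 ?powR_ge0//; exact: sum_dyadic_powR_le.
  rewrite -(@mulr_powRB1 _ (F x) p)// /K.
  by rewrite le_eqVlt; apply/orP; left; apply/eqP; ring.
have mFp : measurable_fun D (fun x => (F x `^ p)%:E).
  by apply/measurable_EFinP; exact: measurableT_comp (measurable_powR p) mF.
apply: (@le_trans _ _ (((s 0%N) `^ q)%:E * V%:E +
    \int[mu]_(x in D) (K%:E * (F x `^ p)%:E))%E).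
  rewrite leeD2l//; apply: ge0_le_integral => //.
  - by move=> x _; exact: nneseries_ge0.
  - by apply: ge0_emeasurable_sum.
  - exact: measurable_funeM.
rewrite ge0_integralZl//; last by move=> x _; rewrite lee_fin powR_ge0.
apply: (@le_trans _ _ ((s 0%N `^ q)%:E * V%:E + K%:E * (N `^ p)%:E)%E).
  by rewrite leeD2l// lee_wpmul2l.
rewrite -!EFinM -EFinD lee_fin sq /t expr0 mul1r.
have aV : a `^ p * V = N `^ p.
  rewrite /a powRM ?powR_ge0 ?(ltW N0)// -powRrM mulNr mulVf ?gt_eqF//.
  by rewrite powR_inv1 ?(ltW V0)// mulfVK ?gt_eqF.
rewrite (powRM _ _ (ltW a0))// /K /frac_sup_cst -/b.
have -> : N `^ q = N `^ (q - p) * N `^ p.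
  by rewrite -powRD ?subrK// (gt_eqF N0) implybT.
rewrite (powRM (q - p) _ (ltW N0))//.
rewrite le_eqVlt; apply/orP; left; apply/eqP.
rewrite -[in RHS]aV; ring: aV.
Qed.

End bound.
End maximal.

(** * Lebesgue measurability in complex space *)

Section real_coordinates.
Variables (R : realType) (n : nat).
Implicit Types (z w : Cn R n) (i : bool * 'I_n.+1).

(** The 2(n+1) real coordinates of complex space; one index type for real and
    imaginary parts avoids treating each of them separately. *)
Definition rcoord i z : R :=
  if i.1 then complex.Re (z 0 i.2) else complex.Im (z 0 i.2).

Lemma normc_lt_real (z : R[i]) (e : R) : (`|z| < e%:C%C) = (cabs z < e).
Proof. by rewrite normc_def ltcR. Qed.

Lemma le_Re_cabs (z : R[i]) : `|complex.Re z| <= cabs z.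
Proof. by rewrite -sqrtr_sqr ler_wsqrtr// lerDl sqr_ge0. Qed.

Lemma le_Im_cabs (z : R[i]) : `|complex.Im z| <= cabs z.
Proof. by rewrite -sqrtr_sqr ler_wsqrtr// lerDr sqr_ge0. Qed.

Lemma cabs_le (z : R[i]) : cabs z <= `|complex.Re z| + `|complex.Im z|.
Proof.
rewrite -[leRHS]ger0_norm ?addr_ge0// -sqrtr_sqr ler_wsqrtr//.
rewrite sqrrD !real_normK ?num_real// lerD2r lerDl.
by rewrite mulrn_wge0// mulr_ge0.
Qed.

Lemma real_of_gt0 (e : R[i]) : 0 < e -> exists2 r : R, 0 < r & e = r%:C%C.
Proof.
case: e => a b; rewrite ltcE/= => /andP[/eqP b0 a0].
by exists a => //; rewrite b0.
Qed.

Lemma continuous_rcoord i : continuous (rcoord i).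
Proof.
move=> z A /nbhs_ballP[e /= e0 eA].
have eC : 0 < (e%:C)%C by rewrite ltcR.
apply: (filterS _ (nbhsx_ballx z _ eC)) => w [_ /(_ 0 i.2)] zw; apply: eA.
move: zw; rewrite /ball/= normc_lt_real; apply: le_lt_trans.
have := (le_Re_cabs (z 0 i.2 - w 0 i.2), le_Im_cabs (z 0 i.2 - w 0 i.2)).
by rewrite /rcoord !raddfB/=; case: ifP => _ [].
Qed.

Lemma nbhs_rcoord z (A : set (Cn R n)) : nbhs z A ->
  exists m, forall w,
    (forall i, `|rcoord i z - rcoord i w| < (2 ^+ m)^-1) -> A w.
Proof.
move=> /nbhs_ballP[_ /= /real_of_gt0[e e0 ->] zeA].
have [m em] := ex_expr2_gt (2 / e).
exists m => w zw; apply: zeA; split; first by rewrite ltcR.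
move=> k j; rewrite (ord1 k) /ball/= normc_lt_real.
apply: (le_lt_trans (cabs_le _)); rewrite !raddfB/=.
have me : (2 ^+ m)^-1 < e / 2.
  by rewrite -(invf_div 2 e) ltf_pV2 ?posrE ?exprn_gt0 ?divr_gt0.
have := ltrD (zw (true, j)) (zw (false, j)).
rewrite /rcoord/= => /lt_trans; apply.
by rewrite [ltRHS]splitr ltrD.
Qed.

End real_coordinates.

Section lebesgue_measurability.
Variables (R : realType) (n : nat).
Implicit Types (z w : Cn R n) (i : bool * 'I_n.+1) (p : Cn R n * Cn R n).

Lemma boxE p z :
  box p z <-> forall i, rcoord i p.1 < rcoord i z <= rcoord i p.2.
Proof.
split=> [pz [[] j]|pz j].
- by have [? ? _ _] := pz j; apply/andP; split.
- by have [_ _ ? ?] := pz j; apply/andP; split.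
- by have /andP[? ?] := pz (true, j); have /andP[? ?] := pz (false, j).
Qed.

Lemma box_volE p :
  box_vol p = \prod_i Num.max 0 (rcoord i p.2 - rcoord i p.1).
Proof.
pose side b j := Num.max 0 (rcoord (b, j) p.2 - rcoord (b, j) p.1).
rewrite (eq_bigr (fun i => side i.1 i.2)); last by case.
rewrite -(pair_bigA _ side)/=.
by rewrite big_bool/= -big_split.
Qed.

Definition set_rcoord i (a : R) z : Cn R n := \row_j
  if j == i.2 then
    (if i.1 then (a +i* complex.Im (z 0 j))%C else (complex.Re (z 0 j) +i* a)%C)
  else z 0 j.

Lemma rcoord_set i a z k :
  rcoord k (set_rcoord i a z) = if k == i then a else rcoord k z.
Proof.
case: i k => [b j] [c l]; rewrite /rcoord /set_rcoord mxE/= xpair_eqE.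
by case: (l == j); case: b; case: c.
Qed.

Definition halfspace i (a : R) : set (Cn R n) := [set z | rcoord i z <= a].

(** Cutting a box by a coordinate hyperplane; the identity also covers
    degenerate boxes and hyperplanes that miss the box. *)
Lemma box_vol_split p i a :
  box_vol p = box_vol (p.1, set_rcoord i (Num.min a (rcoord i p.2)) p.2) +
              box_vol (set_rcoord i (Num.max a (rcoord i p.1)) p.1, p.2).
Proof.
rewrite !box_volE !(bigD1 i (P := xpredT))//= !rcoord_set eqxx.
pose side k := Num.max 0 (rcoord k p.2 - rcoord k p.1).
rewrite [X in _ * X + _](eq_bigr side); last first.
  by move=> k /negbTE ki; rewrite /side rcoord_set ki.
rewrite [X in _ + _ * X](eq_bigr side); last first.
  by move=> k /negbTE ki; rewrite /side rcoord_set ki.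
rewrite -mulrDl; congr (_ * _).
rewrite /Num.max /Num.min; move: (rcoord i p.1) (rcoord i p.2) => x y.
by repeat case: ifPn; rewrite -?leNgt => *; lra.
Qed.

(** Every cover by boxes splits into covers of the two parts with the same
    total volume. *)
Lemma halfspace_measurable i a : @measurable _ (LebCn R n) (halfspace i a).
Proof.
apply: (@le_caratheodory_measurable R (Cn R n) (@lebesgue_outer R n)) => X.
apply: le_ereal_inf_tmp => _ [c Xc <-].
pose cl k : Cn R n * Cn R n :=
  ((c k).1, set_rcoord i (Num.min a (rcoord i (c k).2)) (c k).2).
pose cr k : Cn R n * Cn R n :=
  (set_rcoord i (Num.max a (rcoord i (c k).1)) (c k).1, (c k).2).
rewrite (eq_eseriesr
  (g := fun k => (box_vol (cl k))%:E + (box_vol (cr k))%:E)%E); last first.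
  by move=> k _; rewrite -EFinD -box_vol_split.
rewrite nneseriesD; last 2 first.
- by move=> k _ _; rewrite lee_fin box_vol_ge0.
- by move=> k _ _; rewrite lee_fin box_vol_ge0.
apply: leeD; apply: ereal_inf_lbound.
  exists cl => // z [/Xc[k _ /boxE ckz] za]; exists k => //; apply/boxE => l.
  rewrite /cl rcoord_set; have /andP[-> zc] := ckz l.
  by case: eqP => [->|//]; rewrite le_min za/=; have /andP[] := ckz i.
exists cr => // z [/Xc[k _ /boxE ckz] /negP]; rewrite -ltNge => za.
exists k => //; apply/boxE => l.
rewrite /cr rcoord_set; have /andP[zc ->] := ckz l; rewrite andbT.
by case: eqP => [->|//]; rewrite gt_max za; have /andP[] := ckz i.
Qed.

(** The index of the half-open dyadic cube of side [2 ^- m] that contains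
    [z]. *)
Definition dyadic_code (m : nat) z : {ffun bool * 'I_n.+1 -> int} :=
  [ffun i => Num.ceil (2 ^+ m * rcoord i z)].

Lemma dyadic_code_lt m z w : dyadic_code m z = dyadic_code m w ->
  forall i, `|rcoord i z - rcoord i w| < (2 ^+ m)^-1.
Proof.
move=> /ffunP zw i; have := zw i; rewrite !ffunE => cE.
rewrite -[ltRHS]mulr1 ltr_pdivlMl ?exprn_gt0//.
have := ceil_itv (2 ^+ m * rcoord i z); have := ceil_itv (2 ^+ m * rcoord i w).
rewrite cE => /andP[? ?] /andP[? ?].
rewrite -(ger0_norm (exprn_ge0 m (ler0n R 2))) -normrM mulrBr ltr_norml.
by apply/andP; split; lra.
Qed.

Lemma dyadic_cell_measurable m (k : {ffun bool * 'I_n.+1 -> int}) :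
  @measurable _ (LebCn R n) [set z | dyadic_code m z = k].
Proof.
rewrite (_ : [set z | _] = \bigcap_i (halfspace i ((k i)%:~R / 2 ^+ m) `\`
                                halfspace i ((k i - 1)%:~R / 2 ^+ m))).
  apply: fin_bigcap_measurable => // i _.
  by apply: measurableD; exact: halfspace_measurable.
apply/seteqP; split => z /=.
  move=> <- i _; rewrite /halfspace/= ffunE !ler_pdivlMr ?exprn_gt0//.
  rewrite mulrC; have /andP[? ?] := ceil_itv (2 ^+ m * rcoord i z).
  by split => //; apply/negP; rewrite -ltNge.
move=> zk; apply/ffunP => i; rewrite ffunE; apply: ceil_def.
have [] := zk i I; rewrite /halfspace/= !ler_pdivlMr ?exprn_gt0// mulrC.
move=> -> /negP.
by rewrite -ltNge => ->.
Qed.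

(** An open set is the union of the countably many dyadic cubes that it
    contains. *)
Lemma open_lebesgue_measurable (O : set (Cn R n)) : open O ->
  @measurable _ (LebCn R n) O.
Proof.
move=> oO.
pose C (x : nat * {ffun bool * 'I_n.+1 -> int}) :=
  [set z | dyadic_code x.1 z = x.2].
rewrite (_ : O = \bigcup_x (if `[< C x `<=` O >] then C x else set0)); last first.
  apply/seteqP; split => [z Oz|z [x _]]; last by case: asboolP => // + ?; exact.
  have [m mO] := nbhs_rcoord (open_nbhs_nbhs (conj oO Oz)).
  exists (m, dyadic_code m z) => //; case: asboolP => //; case.
  by move=> w /= wz; apply: mO; apply: dyadic_code_lt.
apply: countable_bigcupT_measurable; first exact: countableP.
by move=> x; case: ifP => // _; exact: dyadic_cell_measurable.
Qed.

Lemma bounded_lebesgue_finite (A : set (Cn R n)) : bounded_set A ->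
  (@dV R n A < +oo)%E.
Proof.
move=> [M0 [M0r AM0]].
have /real_of_gt0[r r0 rE] : 0 < `|M0| + 1 by rewrite ltr_pwDr.
have {AM0} Ar z i : A z -> `|rcoord i z| <= r.
  move=> Az; have : `|z| <= `|M0| + 1.
    by apply: AM0 => //; rewrite (le_lt_trans (real_ler_norm M0r))// ltrDl.
  rewrite rE => zr; have : `|z 0 i.2| <= r%:C%C.
    apply: le_trans zr; rewrite [leRHS]/Num.norm/= mx_normE -[leLHS]nngE num_le.
    exact: (le_bigmax _ _ (0, i.2)).
  rewrite normc_def lecR; apply: le_trans.
  by rewrite /rcoord; case: ifP => _; [exact: le_Re_cabs|exact: le_Im_cabs].
pose corner (a : R) : Cn R n := \row_j (a +i* a)%C.
have cornerE a i : rcoord i (corner a) = a by rewrite /rcoord mxE; case: ifP.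
pose c k : Cn R n * Cn R n :=
  if k is 0%N then (corner (- r - 1), corner r) else (corner 0, corner 0).
apply: (@le_lt_trans _ _ (\sum_(0 <= k <oo) (box_vol (c k))%:E)%E).
  apply: ereal_inf_lbound; exists c => // z Az; exists 0%N => //.
  apply/boxE => i; rewrite !cornerE.
  by have := Ar z i Az; rewrite ler_norml => /andP[? ->]; lra.
rewrite (nneseries_split 0 1); last by move=> k _; rewrite lee_fin box_vol_ge0.
rewrite big_nat1 eseries0 ?adde0 ?ltry// => -[//|k] _ _.
by rewrite box_volE (bigD1 (true, ord0))//= subrr maxxx mul0r.
Qed.
End lebesgue_measurability.

(** * Measurability of tents *)

Section euclidean_continuity.
Variables (R : realType) (n : nat).
Implicit Types (z w : Cn R n) (A B : set (Cn R n)).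

Lemma eucl_normE z : eucl_norm z = Num.sqrt (\sum_i rcoord i z ^+ 2).
Proof.
rewrite /eucl_norm; congr Num.sqrt.
rewrite (eq_bigr (fun i => rcoord (i.1, i.2) z ^+ 2)); last by case.
rewrite -(pair_bigA _ (fun b j => rcoord (b, j) z ^+ 2))/= big_bool/= -big_split.
apply: eq_bigr => j _; rewrite /cabs sqr_sqrtr// addr_ge0 ?sqr_ge0//.
Qed.

Lemma eucl_norm_ge0 z : 0 <= eucl_norm z.
Proof. exact: sqrtr_ge0. Qed.

Lemma rcoordB i z w : rcoord i (z - w) = rcoord i z - rcoord i w.
Proof. by rewrite /rcoord !mxE; case: ifP; rewrite raddfB. Qed.

Lemma continuous_eucl_dist (f g : Cn R n -> Cn R n) w :
  (forall i, {for w, continuous (rcoord i \o f)}) ->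
  (forall i, {for w, continuous (rcoord i \o g)}) ->
  {for w, continuous (fun x => eucl_dist (f x) (g x))}.
Proof.
move=> cf cg.
have -> : (fun x => eucl_dist (f x) (g x)) =
    Num.sqrt \o (fun x => \sum_i (rcoord i (f x) - rcoord i (g x)) ^+ 2).
  apply/funext => x; rewrite /eucl_dist eucl_normE/=; congr Num.sqrt.
  by apply: eq_bigr => i _; rewrite rcoordB.
apply: continuous_comp; last exact: sqrt_continuous.
apply: (@cvg_big R^o _ +%R 0 xpredT (@add_continuous R^o) _ (nbhs w) _ _ _
  (nbhs_filter w)) => i _.
by apply: cvgM; apply: cvgB; [exact: cf|exact: cg|exact: cf|exact: cg].
Qed.


(** The distance to a nonempty set is below [eps0] when some point of the set
    is at distance below [eps0].  If the boundary is empty, the distance is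
    the infimum of the empty set, which is 0. *)
Lemma tube_open Om (eps0 : R) : open (tube Om eps0 : set (Cn R n)).
Proof.
have [b0|/set0P[z0 bz0]] := eqVneq (bdry Om) set0.
  have d0 x : dist_to (bdry Om) x = 0 by rewrite /dist_to b0 image_set0 inf0.
  have [e0|e0] := ltP 0 eps0.
    rewrite (_ : tube _ _ = setT); first exact: openT.
    by apply/seteqP; split => // x _; rewrite /tube/= d0.
  rewrite (_ : tube _ _ = set0); first exact: open0.
  by apply/seteqP; split => // x; rewrite /tube/= d0 ltNge e0.
rewrite openE => w /= /(inf_lt _)[|_ [z bz <-] wz].
  by exists (eucl_dist w z0), z0.
have cd : {for w, continuous (fun x => eucl_dist x z)}.
  apply: continuous_eucl_dist => i; first exact: continuous_rcoord.
  exact: cst_continuous.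
have : nbhs w [set x | eucl_dist x z < eps0].
  exact: (cd [set r | r < eps0] (lt_nbhsl wz)).
apply: (@filterS _ (nbhs w)) => x /= xz; apply: le_lt_trans xz.
apply: ge_inf; last by exists z.
by exists 0 => _ [y _ <-]; exact: eucl_norm_ge0.
Qed.

End euclidean_continuity.

Section tents.
Variables (R : realType) (n : nat) (Om : set (Cn R n)) (eps0 : R).
Hypothesis oOm : open Om.
Hypothesis hproj : smooth_projection Om eps0.
Let pi := proj_bdry Om.

Lemma continuous_proj w i : tube Om eps0 w ->
  {for w, continuous (rcoord i \o pi)}.
Proof.
move=> tw; have [_ /(_ i.2)[sRe sIm]] := hproj.
rewrite /rcoord; case: (i.1).
- exact: (sRe [::] w tw).1.
- exact: (sIm [::] w tw).1.
Qed.

Lemma open_tube_preimage T (g : Cn R n -> T) (A : set T) :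
  (forall w, tube Om eps0 w -> A (g w) -> nbhs w (g @^-1` A)) ->
  open (tube Om eps0 `&` g @^-1` A).
Proof.
move=> gA; rewrite openE => w [tw Aw].
have nt : nbhs w (tube Om eps0).
  by apply: open_nbhs_nbhs; split => //; exact: tube_open.
exact: (@filterI _ (nbhs w) _ _ _ nt (gA _ tw Aw)).
Qed.

Lemma proj_preimage_measurable (B : set (Cn R n)) : borel B ->
  @measurable _ (LebCn R n) (tube Om eps0 `&` pi @^-1` B).
Proof.
have mt : @measurable _ (LebCn R n) (tube Om eps0).
  exact/open_lebesgue_measurable/tube_open.
pose S := [set B | @measurable _ (LebCn R n) (tube Om eps0 `&` pi @^-1` B)].
suff : <<s @open (Cn R n) >> `<=` S by exact.
apply: smallest_sub.
  split.
  - by rewrite /S/= preimage_set0 setI0.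
  - move=> A SA; rewrite /S/= (_ : _ `&` _ =
      tube Om eps0 `\` (tube Om eps0 `&` pi @^-1` A)); first exact: measurableD.
    apply/seteqP; split => [w [tw [_ nA]]|w [tw nA]]; first by split => // -[].
    by split=> //; split => // Aw; exact: nA.
  - move=> A SA; rewrite /S/= preimage_bigcup setI_bigcupr.
    exact: bigcupT_measurable.
move=> O oO; apply: open_lebesgue_measurable.
apply: open_tube_preimage => w tw Ow.
have [m mO] := nbhs_rcoord (open_nbhs_nbhs (conj oO Ow)).
have m0 : 0 < (2 ^+ m)^-1 :> R by rewrite invr_gt0 exprn_gt0.
have near_w i :
    nbhs w [set x | `|rcoord i (pi w) - rcoord i (pi x)| < (2 ^+ m)^-1].
  exact: (@cvgr_dist_lt _ _ _ (nbhs w) _ _ _ (continuous_proj (i := i) tw)).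
have := @filter_forall _ _ _ (nbhs w) (nbhs_filter w) near_w.
by apply: (@filterS _ (nbhs w) (nbhs_filter w)) => x; exact: mO.
Qed.

Lemma tent_measurable (Q : set (Cn R n)) l : borel Q ->
  @measurable _ (LebCn R n) (tent Om eps0 Q l).
Proof.
move=> bQ.
have mt : @measurable _ (LebCn R n) (tube Om eps0).
  exact/open_lebesgue_measurable/tube_open.
pose far :=
  tube Om eps0 `&` (fun w => eucl_dist (pi w) w) @^-1` [set r | l < r].
have mfar : @measurable _ (LebCn R n) far.
  apply: open_lebesgue_measurable; apply: open_tube_preimage => w tw lw.
  have cd : {for w, continuous (fun x => eucl_dist (pi x) x)}.
    apply: continuous_eucl_dist => i; first exact: continuous_proj.
    exact: continuous_rcoord.
  exact: (cd [set r | l < r] (lt_nbhsr lw)).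
rewrite (_ : tent _ _ _ _ = Om `&` (tube Om eps0 `&` pi @^-1` Q) `\` far).
  apply: measurableD => //; apply: measurableI.
    exact: open_lebesgue_measurable.
  exact: proj_preimage_measurable.
apply/seteqP; split => [w [Ow tw Qw wl]|w [[Ow [tw Qw]] nfar]].
  by split=> // -[_ /=]; rewrite ltNge wl.
by split => //; rewrite leNgt; apply/negP => lw; exact: nfar.
Qed.

End tents.

(** * Dyadic cubes and tents *)

Section cubes.
Variables (R : realType) (n : nat) (Om U : set (Cn R n)) (rho : Cn R n -> R).
Variable P : polydisc_data R n.
Hypothesis hP : polydisc_system P Om U rho.

Lemma polydisc_nbhs (c : Cn R n) r : bdry Om c -> 0 < r < pd_radius P ->
  nbhs c (polydiscD P c r).
Proof.
have [[_ bN _] _ hC _] := hP.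
move=> /bN cN rP; have [[[oV Vc] Phic hPhi _ _] _ tau0 _ _] := hC _ _ cN rP.
have cPhi : {for c, continuous (pd_chart P c r)}.
  exact/differentiable_continuous/hPhi.
have nV : nbhs c (pd_dom P c r) by exact: open_nbhs_nbhs.
have nj j : nbhs c [set w | cabs (pd_chart P c r w 0 j) < pd_tau P c r j].
  apply: (cPhi [set x | cabs (x 0 j) < pd_tau P c r j]); rewrite Phic.
  have tC : 0 < ((pd_tau P c r j)%:C)%C by rewrite ltcR.
  apply: (@filterS _ (nbhs (0 : Cn R n)) (nbhs_filter _) _ _ _
    (nbhsx_ballx 0 _ tC)).
  move=> x [_ /(_ 0 j)]; rewrite /ball/= mxE sub0r normrN.
  by rewrite normc_lt_real.
have nall := @filter_forall _ _ _ (nbhs c) (nbhs_filter c) nj.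
exact: (@filterI _ (nbhs c) (nbhs_filter c) _ _ nV nall).
Qed.

(** The quasi-balls are defined by the infimum of the radii of the polydiscs
    that contain a point, so they contain the trace of a small polydisc. *)
Lemma qball_nbhs (c : Cn R n) e : bdry Om c -> 0 < e ->
  exists2 N, nbhs c N & bdry Om `&` N `<=` qball P Om c e.
Proof.
move=> bc e0; have [_ P0 _ _] := hP.
pose r := Num.min e (pd_radius P) / 2.
have m0 : 0 < Num.min e (pd_radius P) by rewrite lt_min e0.
have r0 : 0 < r by rewrite divr_gt0.
have rm : r < Num.min e (pd_radius P) by rewrite /r; lra.
move: (rm); rewrite lt_min => /andP[re rP].
exists (polydiscD P c r); first by apply: polydisc_nbhs => //; rewrite r0.
move=> w [bw Nw]; split => //; apply: le_lt_trans re; apply: ge_inf.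
  by exists 0 => x [/ltW].
by split => //; split => //; rewrite rP.
Qed.

Variable D : dyadic_grid Om P.

Lemma cube_center_nbhs k Q : (1 <= k)%N -> dg_cubes D k Q ->
  exists2 N, nbhs (dg_center D k Q) N & bdry Om `&` N `<=` Q.
Proof.
move=> k1 DQ; have /andP[d0 _] := dg_delta_itv D.
have [N cN NQ] := qball_nbhs (dg_center_bdry k1 DQ) (exprn_gt0 k d0).
by exists N => // x /NQ; exact: (dg_balls k1 DQ).1.
Qed.

Lemma cube_center k Q : (1 <= k)%N -> dg_cubes D k Q -> Q (dg_center D k Q).
Proof.
move=> k1 DQ; have [N cN NQ] := cube_center_nbhs k1 DQ; apply: NQ.
by split; [exact: dg_center_bdry | exact: nbhs_singleton].
Qed.

(** If one cube contains another of the same generation, both are parents of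
    any child of the smaller one. *)
Lemma cube_eq k Q1 Q2 : (1 <= k)%N -> dg_cubes D k Q1 -> dg_cubes D k Q2 ->
  Q1 `&` Q2 !=set0 -> Q1 = Q2.
Proof.
move=> k1.
suff sub (A B : set (Cn R n)) :
    dg_cubes D k A -> dg_cubes D k B -> A `<=` B -> A = B.
  move=> D1 D2 /(dg_nested k1 k1 D1 D2)[|]; first exact: sub.
  by move=> Q21; apply/esym; exact: sub.
move=> DA DB AB; have [C DC CA] := dg_child k1 DA.
have [X [_ XC]] := dg_parent k1 DC.
by rewrite -(XC A) ?(XC B)//; split => //; exact: subset_trans AB.
Qed.

Lemma cube_ancestor j k Q : (1 <= j)%N -> (j <= k)%N -> dg_cubes D k Q ->
  exists2 Q', dg_cubes D j Q' & Q `<=` Q'.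
Proof.
move=> j1 /subnK <-; elim: (k - j)%N Q => [|i IH] Q DQ; first by exists Q.
have [Q1 [[D1 QQ1] _]] := dg_parent (leq_trans j1 (leq_addl i j)) DQ.
have [Q2 D2 Q12] := IH _ D1.
by exists Q2 => //; exact: subset_trans Q12.
Qed.

(** A cube is encoded by a dyadic cube around its center whose points in the
    boundary it contains.  If two cubes have the same code, the center of one
    lies in both of them, hence they are equal. *)
Lemma cubes_countable k : (1 <= k)%N -> countable (dg_cubes D k).
Proof.
move=> k1.
have /choice[m mP] (Q : set (Cn R n)) : exists m, dg_cubes D k Q ->
    forall w, bdry Om w -> (forall i,
      `|rcoord i (dg_center D k Q) - rcoord i w| < (2 ^+ m)^-1) -> Q w.
  have [DQ|nDQ] := pselect (dg_cubes D k Q); last by exists 0%N.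
  have [N cN NQ] := cube_center_nbhs k1 DQ; have [m mN] := nbhs_rcoord cN.
  by exists m => _ w bw cw; apply: NQ; split => //; exact: mN.
apply/countable_injP.
exists (fun Q => pickle (m Q, dyadic_code (m Q) (dg_center D k Q))).
move=> Q1 Q2; rewrite !inE => D1 D2 /(pcan_inj pickleK)[m12 c12].
apply: (cube_eq k1 D1 D2); exists (dg_center D k Q2).
split; last exact: cube_center.
apply: mP => //; first exact: dg_center_bdry.
by apply: dyadic_code_lt; rewrite c12 m12.
Qed.

Variable eps0 : R.

Lemma dyadic_extension_countable : countable (dyadic_extension D eps0).
Proof.
pose C k := if k is 0%N then [set Om] else
  (fun Q => tent Om eps0 Q (dg_delta D ^+ k)) @` dg_cubes D k.
apply: (@sub_countable _ _ _ (\bigcup_k C k)).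
  apply: subset_card_le => T [->|[k [Q [k1 DQ ->]]]]; first by exists 0%N.
  by exists k => //; case: k k1 DQ => // k _ DQ; exists Q.
apply: bigcup_countable => // -[|k] _; first exact: countable1.
by apply: sub_countable (card_image_le _ _) _; exact: cubes_countable.
Qed.

(** The ancestor of [Q2] in the generation of [Q1] meets [Q1] at the
    projection of a common point of the tents, hence equals [Q1]. *)
Lemma tents_nested j k Q1 Q2 : (1 <= j)%N -> (j <= k)%N ->
  dg_cubes D j Q1 -> dg_cubes D k Q2 ->
  let T1 := tent Om eps0 Q1 (dg_delta D ^+ j) in
  let T2 := tent Om eps0 Q2 (dg_delta D ^+ k) in
  T1 `&` T2 !=set0 -> T2 `<=` T1.
Proof.
move=> j1 jk D1 D2 T1 T2 [w [[_ _ Q1w _] [_ _ Q2w _]]].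
have [Q D_Q Q2Q] := cube_ancestor j1 jk D2.
have Q1E : Q1 = Q.
  apply: (cube_eq j1 D1 D_Q); exists (proj_bdry Om w).
  by split => //; exact: Q2Q.
move=> x [Ox tx Q2x xl]; split => //; first by rewrite Q1E; exact: Q2Q.
have /andP[d0 /ltW d1] := dg_delta_itv D.
by rewrite (le_trans xl)// ler_wiXn2l// ltW.
Qed.

Lemma dyadic_extension_sub T : dyadic_extension D eps0 T -> T `<=` Om.
Proof. by move=> [->//|[k [Q [_ _ ->]]]] x []. Qed.

Lemma dyadic_extension_laminar : laminar (dyadic_extension D eps0).
Proof.
move=> A B TA TB AB.
case: TA (TA) AB => [->|[j [Q1 [j1 D1 ->]]]] TA AB.
  by right; exact: dyadic_extension_sub.
case: TB (TB) AB => [->|[k [Q2 [k1 D2 ->]]]] TB AB.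
  by left; exact: dyadic_extension_sub.
have [jk|/ltnW kj] := leqP j k.
  by right; exact: (tents_nested j1 jk D1 D2).
by left; apply: (tents_nested k1 kj D2 D1); rewrite setIC.
Qed.

End cubes.

(** * Boundedness on the Lebesgue spaces *)

Section norms.
Variables (R : realType) (n : nat) (Om : set (Cn R n)).

Lemma measurable_cabs (f : Cn R n -> R[i]) :
  @measurable_fun _ _ (LebCn R n) R Om (fun z => complex.Re (f z)) ->
  @measurable_fun _ _ (LebCn R n) R Om (fun z => complex.Im (f z)) ->
  @measurable_fun _ _ (LebCn R n) R Om (fun z => cabs (f z)).
Proof.
move=> mRe mIm.
have msqrt : measurable_fun setT (@Num.sqrt R).
  by apply: continuous_measurable_fun; exact: sqrt_continuous.
apply: (measurableT_comp msqrt).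
by apply: measurable_funD; exact: measurable_funX.
Qed.

Lemma Lp_normE (r : R) (g : Cn R n -> \bar R) : 0 < r ->
  Lp_norm Om r g = ((\int[@dV R n]_(z in Om) (`|g z| `^ r)) `^ r^-1)%E.
Proof.
move=> r0; rewrite /Lp_norm unlock; congr (_ `^ _)%E.
rewrite [RHS]integral_mkcond; apply: eq_integral => z _.
rewrite /patch; case: ifP => // _.
by rewrite abse0 poweR0r// gt_eqF.
Qed.

End norms.

Theorem lemma4p5 (R : realType) (n : nat)
  (Om : set (Cn R n))
  (hdom : bounded_domain Om)
  (hpsc : smooth_strictly_pseudoconvex Om)
  (U : set (Cn R n)) (rho : Cn R n -> R)
  (hrho : defining_function Om U rho)
  (hgrad : forall z, bdry Om z -> grad_norm rho z = 1)
  (P : polydisc_data R n)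
  (hP : polydisc_system P Om U rho)
  (eps0 : R)
  (heps0 : 0 < eps0)
  (hproj : smooth_projection Om eps0)
  (D : dyadic_grid Om P)
  (hdelta : dg_delta D < eps0)
  (alpha p q : R)
  (halpha : 0 < alpha < 1)
  (hp : 1 < p)
  (hpq : p < q)
  (hsum : p^-1 - q^-1 = alpha) :
  bounded_Lp_Lq Om (frac_maximal (dyadic_extension D eps0) alpha) p q.
Proof.
have [oOm _ _ bOm] := hdom.
have p0 : 0 < p by rewrite (lt_trans ltr01).
have q0 : 0 < q by rewrite (lt_trans p0).
have mOm : @measurable _ (LebCn R n) Om by exact: open_lebesgue_measurable.
have mT A : dyadic_extension D eps0 A ->
    @measurable _ (LebCn R n) A /\ A `<=` Om.
  move=> TA; split; last exact: dyadic_extension_sub TA.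
  case: TA => [->//|[k [Q [k1 DQ ->]]]].
  by apply: tent_measurable => //; exact: dg_borel DQ.
have [V V0 OmV] : exists2 V : R, 0 < V & (@dV R n Om <= V%:E)%E.
  have Omoo := bounded_lebesgue_finite bOm.
  have Om0 : (0 <= @dV R n Om)%E by exact: lebesgue_outer_ge0.
  exists (fine (@dV R n Om) + 1); first by rewrite ltr_wpDl ?fine_ge0.
  by rewrite EFinD fineK ?ge0_fin_numE// leeDl.
pose K := frac_sup_cst p q `^ q^-1 + 1.
have K0 : 0 < K by rewrite ltr_wpDl ?powR_ge0.
exists K => f [mRe mIm foo].
pose F z := cabs (f z).
have F0 z : 0 <= F z by exact: sqrtr_ge0.
have mF : @measurable_fun _ _ (LebCn R n) R Om F by exact: measurable_cabs.
have cT := dyadic_extension_countable hP D eps0.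
have lT := dyadic_extension_laminar (D := D) (eps0 := eps0).
have TOm : dyadic_extension D eps0 Om by left.
split.
  exact: (measurable_frac_sup (@dV R n) F mOm cT TOm mT alpha).
have FE : Lp_norm Om p (fun z => (F z)%:E) =
    ((\int[@dV R n]_(z in Om) (F z `^ p)%:E) `^ p^-1)%E.
  rewrite Lp_normE//; congr (_ `^ _)%E; apply: eq_integral => z _.
  by rewrite /= ger0_norm.
have I0 : (0 <= \int[@dV R n]_(z in Om) (F z `^ p)%:E)%E.
  by apply: integral_ge0 => z _; rewrite lee_fin powR_ge0.
(* [N] is any positive bound, so that the norm of [f] may vanish. *)
have bound N : 0 < N -> (Lp_norm Om p (fun z => (F z)%:E) <= N%:E)%E ->
  (Lp_norm Om q (frac_maximal (dyadic_extension D eps0) alpha f) <=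
   (K * N)%:E)%E.
  move=> N0 FN.
  have IN : (\int[@dV R n]_(z in Om) (F z `^ p)%:E <= (N `^ p)%:E)%E.
    rewrite -[leLHS]poweRe1// -(@mulVf _ p) ?gt_eqF// poweRrM -FE -poweR_EFin.
    apply: gt0_ler_poweR; rewrite ?in_itv/= ?leey ?andbT ?lee_fin//.
    - exact: ltW.
    - exact: Lnorm_ge0.
    - exact: ltW.
  have := frac_sup_strong mOm V0 OmV mF F0 cT TOm mT lT hp hpq (esym hsum) N0 IN.
  move=> MN; rewrite Lp_normE//.
  rewrite (eq_integral (fun z =>
    (frac_sup (@dV R n) F (dyadic_extension D eps0) alpha z `^ q)%E)); last first.
    move=> z; rewrite inE => Oz; rewrite gee0_abs//.
    exact: (frac_sup_ge0 (@dV R n) F0 TOm alpha Oz).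
  apply: (@le_trans _ _ ((frac_sup_cst p q * N `^ q)%:E `^ q^-1)%E).
    apply: gt0_ler_poweR => //; rewrite ?invr_ge0 ?(ltW q0)// in_itv/= leey andbT.
      by apply: integral_ge0 => z _; exact: poweR_ge0.
    by rewrite lee_fin mulr_ge0 ?powR_ge0 ?frac_sup_cst_ge0.
  rewrite poweR_EFin lee_fin powRM ?powR_ge0 ?frac_sup_cst_ge0// -powRrM.
  by rewrite divff ?gt_eqF// powRr1 ?(ltW N0)// /K mulrDl lerDl mul1r ltW.
have FN0 : (0 <= Lp_norm Om p (fun z => (F z)%:E))%E by exact: Lnorm_ge0.
rewrite -/(Lp_norm Om p (fun z => (F z)%:E)) in foo *.
case: (Lp_norm Om p (fun z => (F z)%:E)) foo FN0 bound => [r| |]// _.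
rewrite lee_fin => r0 bound; apply/lee_addgt0Pr => e e0.
have eK : 0 < e / K by rewrite divr_gt0.
have := bound (r + e / K); rewrite ltr_wpDl// lee_fin lerDl (ltW eK).
by rewrite mulrDr mulrCA divff ?gt_eqF// mulr1 EFinD EFinM; exact.
Qed.
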